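(* Let $G$ be a finite noncyclic nilpotent group of order $n=p_1^{\alpha_1}p_2^{\alpha_2}$, where $p_1<p_2$ are primes and $\alpha_1,\alpha_2\geq1$. For $i\in\{1,2\}$ let $P_i$ be the unique Sylow $p_i$-subgroup of $G$. Suppose that $P_1$ is cyclic and the center $Z(P_2)$ is noncyclic. Then $\delta(\mathcal{P}(G))=\deg(y_2)$, where $\langle y_2\rangle\in\mathcal{M}(P_2)$ is of minimum order.
   Context: For a finite group $G$, the power graph $\mathcal{P}(G)$ is the simple graph with vertex set $G$ in which two distinct vertices are adjacent iff one is a positive power of the other. $\deg(v)$ denotes the degree of a vertex $v$ in $\mathcal{P}(G)$ and $\delta(\mathcal{P}(G))=\min_{v\in G}\deg(v)$. For a finite group $H$, a cyclic subgroup of $H$ is maximal cyclic if it is not properly contained in any cyclic subgroup of $H$; $\mathcal{M}(H)$ denotes the set of maximal cyclic subgroups of $H$. Here $\deg(y_2)$ is the degree of $y_2$ in $\mathcal{P}(G)$. *)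

(* Defs.v *)
From mathcomp Require Import all_boot all_fingroup all_solvable.

Set Implicit Arguments.
Unset Strict Implicit.
Unset Printing Implicit Defensive.

Import GroupScope.

Section PowerGraph.

Variable gT : finGroupType.
Implicit Types (x y v : gT) (G H : {group gT}).

Definition pos_power x y : Prop := exists2 m : nat, 0 < m & y = x ^+ m.

Lemma pos_powerP x y : reflect (pos_power x y) (y \in <[x]>).
Proof.
apply: (iffP (cycleP x y)) => [[m ->]|[m _ ->]]; last by exists m.
by exists (m + #[x]); rewrite ?addn_gt0 ?order_gt0 ?orbT // expgD expg_order mulg1.
Qed.

Lemma pos_power_dec x y : decidable (pos_power x y).
Proof. exact: decP (pos_powerP x y). Qed.

Definition power_adj : rel gT :=
  fun x y => (x != y) && (pos_power_dec x y || pos_power_dec y x).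

Definition power_deg G v : nat := #|[set w in G | power_adj v w]|.

Definition power_min_deg G : nat :=
  power_deg G [arg min_(v < 1 in G) power_deg G v].

Definition max_cyclic H : {set {group gT}} :=
  [set C : {group gT} | [max C of K | cyclic K & K \subset H]].

End PowerGraph.

(* Main.v *)
Require Import Defs.
From mathcomp Require Import all_boot all_fingroup all_solvable.
Import GroupScope.

(** Write [N v] for the closed neighbourhood of [v], so [deg v = #|N v| - 1],
    and decompose [v = x * y] along [G = P1 \x P2].

    If [<[y]>] is maximal cyclic in [P2], then, subgroups of the cyclic
    [p1]-group [P1] forming a chain, [N (x * y)] contains [N y], which has
    [#[y] + (#|P1| - 1) * totient #[y]] elements. This is monotone in the
    [p2]-power [#[y]], hence minimal at [y2].

    Otherwise [<[y]>] is properly contained in a maximal cyclic [<[z]>]. A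
    central [e] of order [p2] outside [<[z]>] provides [p2 * totient #[z]]
    elements [g * e ^+ i] whose cyclic subgroups contain [y], so at least
    [2 * #[z]] of them as [p2 >= 3]. At least half of [P1] generates [P1],
    so [#|N (x * y)| >= #|P1| * #[z] >= #|P1| * #[y2] >= #|N y2|]. *)

(** * Counting in products and in [p]-groups *)

Section GroupFacts.

Set Implicit Arguments.
Unset Strict Implicit.

Variable gT : finGroupType.
Implicit Types (x y z u v w : gT) (G H K P Q : {group gT}) (A B : {set gT}).

(** If [a * b = c * d], then [c^-1 * a = d * b^-1] lies in [H :&: K], so a product determines its
    factors. *)
Lemma card_mulg_TI H K A B :
  H :&: K = 1 -> A \subset H -> B \subset K -> #|A * B| = (#|A| * #|B|)%N.
Proof.
move=> tiHK /subsetP sAH /subsetP sBK.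
rewrite -[A * B]/(mulg @2: (A, B)) curry_imset2X card_in_imset ?cardsX //.
move=> [a b] [c d] /setXP[/= /sAH Ha /sBK Kb] /setXP[/= /sAH Hc /sBK Kd] eq_ab.
have /eqP : c^-1 * a = d * b^-1.
  by apply: (mulgI c); rewrite mulKVg mulgA -eq_ab mulgK.
have [eq1 _|] := eqVneq (c^-1 * a) 1.
  have eq_ac : a = c by rewrite -[a](mulKVg c) eq1 mulg1.
  by move: eq_ab; rewrite eq_ac => /mulgI->.
move=> neq /eqP eq1; case/eqP: neq; apply/set1gP; rewrite -tiHK inE.
by rewrite groupM ?groupV //= eq1 groupM ?groupV.
Qed.

(** In a cyclic group, inclusion of subgroups is divisibility of orders, and powers of [p] form a
    chain under divisibility. *)
Lemma cyclic_pgroup_cycle_total p P x u :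
    prime p -> p.-group P -> cyclic P -> x \in P -> u \in P ->
  (u \in <[x]>) || (x \in <[u]>).
Proof.
move=> pr_p pP cycP Px Pu; rewrite -!cycle_subG.
have dvdE (a b : gT) : a \in P -> b \in P ->
    (<[a]> \subset <[b]>) = (logn p #[a] <= logn p #[b]).
  move=> Pa Pb; rewrite -(cardSg_cyclic cycP) ?cycle_subG //.
  rewrite (card_pgroup (mem_p_elt pP Pa)) (card_pgroup (mem_p_elt pP Pb)).
  by rewrite dvdn_Pexp2l ?prime_gt1.
by rewrite !dvdE // leq_total.
Qed.

Lemma leq_totient_pexp p i j :
  prime p -> i <= j -> totient (p ^ i) <= totient (p ^ j).
Proof.
(* Exponent 0 is apart: [totient 1 = 1] does not fit the formula for prime powers. *)
move=> pr_p; case: i => [|i] le_ij; first by rewrite totient_gt0 expn_gt0 prime_gt0.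
rewrite !totient_pfactor ?(leq_trans _ le_ij) // leq_mul //.
by rewrite leq_pexp2l ?prime_gt0 //; case: j le_ij.
Qed.

(** A cyclic group of order [p ^ k.+1] has [p.-1 * p ^ k] generators, and [p <= 2 * p.-1]. *)
Lemma cyclic_pgroup_generators p P :
    prime p -> p.-group P -> P :!=: 1 -> cyclic P ->
  #|P| <= 2 * #|[set u | generator P u]|.
Proof.
move=> pr_p pP ntP cycP; have [_ _ [k oP]] := pgroup_pdiv pP ntP.
have /cyclicP[g defP] := cycP.
have -> : #|[set u | generator P u]| = totient #|P| by rewrite defP -totient_gen.
rewrite oP totient_pfactor // expnS mulnA leq_mul2r; apply/orP; right.
by case: p pr_p {pP oP} => [|[|p]] // _; rewrite mul2n -addnn addSn ltnS leq_addl.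
Qed.

(** A noncyclic abelian [p]-group has rank at least 2, and an elementary abelian subgroup of order
    [p ^ 2] does not fit in a cyclic group. *)
Lemma noncyclic_center_avoids_cycle (p : nat) P x :
    p.-group P -> ~~ cyclic 'Z(P) ->
  exists e, [/\ e \in 'Z(P), #[e] = p & e \notin <[x]>].
Proof.
move=> pP ncZ; have pZ : p.-group 'Z(P) := pgroupS (center_sub P) pP.
have : 2 <= 'r_p('Z(P)).
  by rewrite -(rank_pgroup pZ) ltnNge -abelian_rank1_cyclic ?center_abelian.
case/p_rank_geP=> E /pnElemP[sEZ abelE oE].
have /subsetPn[e Ee notxe] : ~~ (E \subset <[x]>).
  apply/negP => /cyclicS/(_ (cycle_cyclic x)).
  by rewrite (abelem_cyclic abelE) oE.
exists e; split=> //; first exact: (subsetP sEZ).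
apply: (abelem_order_p abelE Ee).
by apply: contraNneq notxe => ->; apply: group1.
Qed.

(** For [g] generating [<[x]>], the [p]-th power of [g * e ^+ j] is [g ^+ p], which generates the
    unique maximal subgroup of [<[x]>] and so has [y] among its powers. *)
Lemma card_cycle_overgroups p P x y :
    prime p -> p.-group P -> ~~ cyclic 'Z(P) -> x \in P ->
    <[y]> \proper <[x]> ->
  p.-1 * #[x] <= #|[set z in P | y \in <[z]>]|.
Proof.
move=> pr_p pP ncZ Px /andP[syx not_sxy].
have [e [Ze oe notxe]] := noncyclic_center_avoids_cycle x pP ncZ.
have /centerP[Pe cPe] := Ze.
have ntx : <[x]> != 1 by apply: contraNneq not_sxy => ->; apply: sub1G.
have [_ _ [k ox]] := pgroup_pdiv (mem_p_elt pP Px) ntx.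
have /cycleP[i def_y] : y \in <[x]> by rewrite -cycle_subG.
(* Otherwise [y = x ^+ i] would generate [<[x]>]. *)
have /dvdnP[l def_i] : p %| i.
  apply: contraR not_sxy => p'i; rewrite def_y.
  suff /eqP-> : generator <[x]> (x ^+ i) by [].
  by rewrite generator_coprime orderE ox coprime_pexpl // prime_coprime.
pose A := [set g | generator <[x]> g].
have sAx : A \subset <[x]>.
  by apply/subsetP=> g; rewrite inE => /cycle_generator.
have tixe : <[x]> :&: <[e]> = 1.
  by rewrite setIC prime_TIg -?orderE ?oe // cycle_subG.
(* This is [p * totient (p ^ k.+1) = p.-1 * p ^ k.+1]. *)
have <- : #|A * <[e]>| = (p.-1 * #[x])%N.
  rewrite (card_mulg_TI tixe) // -totient_gen -orderE oe orderE ox.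
  by rewrite totient_pfactor // -mulnA -expnSr.
apply/subset_leq_card/subsetP => _ /mulsgP[g _ + /cycleP[j ->] ->].
rewrite !inE => gen_g; have xg := cycle_generator gen_g.
have Pg : g \in P by apply: subsetP xg; rewrite cycle_subG.
rewrite groupM ?groupX //=.
have /cycleP[h def_x] : x \in <[g]> by rewrite -(eqP gen_g) cycle_id.
(* Here [y = x ^+ (l * p)] and [x = g ^+ h], while the [p]-th power kills [e ^+ j]. *)
have -> : y = ((g * e ^+ j) ^+ p) ^+ (h * l); last by rewrite -expgM mem_cycle.
have cge : commute g (e ^+ j) by apply/commuteX/commute_sym/cPe.
rewrite expgMn // [e ^+ j ^+ p]expgAC -oe expg_order expg1n mulg1 oe.
by rewrite def_y def_i def_x -!expgM mulnA mulnC.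
Qed.

End GroupFacts.

(** * Closed neighbourhoods in the power graph *)

Section PowerNeighbourhoods.

Set Implicit Arguments.
Unset Strict Implicit.

Variable gT : finGroupType.
Implicit Types (x y z u v w : gT) (G P Q : {group gT}).

Definition power_nbhd G v := [set w in G | (w \in <[v]>) || (v \in <[w]>)].

Lemma pos_power_decE x y : pos_power_dec x y = (y \in <[x]>) :> bool.
Proof.
by case: pos_power_dec => xy /=; symmetry; [apply/pos_powerP | apply/negP => /pos_powerP].
Qed.

Lemma card_power_nbhd G v : v \in G -> #|power_nbhd G v| = (power_deg G v).+1.
Proof.
move=> Gv; rewrite (cardsD1 v) inE Gv cycle_id add1n; congr _.+1.
apply: eq_card => w; rewrite !inE /power_adj !pos_power_decE eq_sym.
by rewrite andbCA.
Qed.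

(** Every cyclic subgroup is some [<[z]>], so maximality can be tested on elements. *)
Lemma mem_max_cyclic P x :
  reflect (x \in P /\ forall z, z \in P -> x \in <[z]> -> z \in <[x]>)
          (<[x]>%G \in max_cyclic P).
Proof.
rewrite inE; apply: (iffP maxgroupP) => [[/andP[_ sxP] maxx]|[Px maxx]].
  split=> [|z Pz xz]; first by rewrite -cycle_subG.
  have := maxx <[z]>%G; rewrite cycle_cyclic !cycle_subG => /(_ Pz xz) /= <-.
  exact: cycle_id.
split=> [|H /andP[/cyclicP[z defH] sHP]]; first by rewrite cycle_cyclic cycle_subG.
rewrite cycle_subG => Hx; apply/eqP; rewrite /= eqEsubset cycle_subG Hx andbT.
by move: Hx sHP; rewrite /= defH !cycle_subG => xz Pz; apply: maxx.
Qed.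

(** * Neighbourhoods in a direct product of coprime orders *)

Section DirectProduct.

Variables G P Q : {group gT}.
Hypotheses (defG : P \x Q = G) (coPQ : coprime #|P| #|Q|).

(** Coprime orders give [<[u * z]> = <[u]> * <[z]>]; the converse is uniqueness of components. *)
Lemma mem_cycle_dprod x y u z : x \in P -> u \in P -> y \in Q -> z \in Q ->
  (x * y \in <[u * z]>) = (x \in <[u]>) && (y \in <[z]>).
Proof.
move=> Px Pu Qy Qz; have [_ _ cPQ _] := dprodP defG.
have cuz : commute u z by apply/commute_sym; apply: (centP (subsetP cPQ _ Qz)).
apply/cycleP/andP => [[k eq_k]|[ux zy]]; last first.
  apply/cycleP; rewrite cycleM ?mem_mulg //.
  by rewrite (coprime_dvdl (order_dvdG Pu)) // (coprime_dvdr (order_dvdG Qz)).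
have Gxy : x * y \in G by have [_ <- _ _] := dprodP defG; rewrite mem_mulg.
have [a [b [_ _ _ uniq_ab]]] := mem_dprod defG Gxy.
have [-> ->] := uniq_ab x y Px Qy (erefl _).
rewrite expgMn // in eq_k.
have [<- <-] := uniq_ab _ _ (groupX k Pu) (groupX k Qz) eq_k.
by rewrite !mem_cycle.
Qed.

(** If [y] is a power of [u * z], it is a power of [z], and maximality makes [z] generate [<[y]>].
    Taking [u] in [P^#] keeps the two pieces disjoint for counting. *)
Lemma power_nbhd_max_cyclic y : <[y]>%G \in max_cyclic Q ->
  power_nbhd G y = (P^# * [set z | generator <[y]> z]) :|: <[y]>.
Proof.
move=> /mem_max_cyclic[Qy maxy]; have [_ mulPQ _ _] := dprodP defG.
have sQG : Q \subset G by rewrite -mulPQ mulG_subr.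
apply/setP=> w; rewrite [LHS]inE [RHS]inE.
have [yw|not_yw] /= := boolP (w \in <[y]>).
  by rewrite andbT orbT (subsetP sQG) // (subsetP _ _ yw) // cycle_subG.
rewrite !orbF; apply/andP/mulsgP => [[Gw wy]|[u z]].
  have [u [z [Pu Qz def_w _]]] := mem_dprod defG Gw.
  move: wy; rewrite def_w -{1}[y]mul1g mem_cycle_dprod ?group1 //= => zy.
  have yz := maxy z Qz zy.
  exists u z => //; last by rewrite inE /generator eqEsubset !cycle_subG zy yz.
  by rewrite !inE Pu andbT; apply: contraNneq not_yw => u1; rewrite def_w u1 mul1g.
rewrite !inE => /andP[_ Pu] gen_z def_w.
have Qz : z \in Q by apply: subsetP (cycle_generator gen_z); rewrite cycle_subG.
have zy : y \in <[z]> by rewrite -(eqP gen_z) cycle_id.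
rewrite def_w -mulPQ mem_mulg //; split=> //.
by rewrite -[y]mul1g mem_cycle_dprod ?group1.
Qed.

Lemma card_power_nbhd_max_cyclic y : <[y]>%G \in max_cyclic Q ->
  #|power_nbhd G y| = (#|P|.-1 * totient #[y] + #[y])%N.
Proof.
move=> maxy; have [Qy _] := mem_max_cyclic _ _ maxy.
have [_ _ _ tiPQ] := dprodP defG.
have sgQ : [set z | generator <[y]> z] \subset Q.
  apply/subsetP=> z; rewrite inE => /cycle_generator; apply: subsetP.
  by rewrite cycle_subG.
rewrite power_nbhd_max_cyclic // cardsU (card_mulg_TI tiPQ) ?subD1set //.
rewrite [#|P|](cardsD1 1) group1 totient_gen -orderE.
(* If [u * z] and [z] both lie in [<[y]>], then [u] lies in [P :&: Q = 1]. *)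
rewrite (_ : _ :&: _ = set0) ?cards0 ?subn0 //.
apply/setP=> w; rewrite !inE; apply/andP => -[/mulsgP[u z]].
rewrite !inE => /andP[/negP ntu Pu] gen_z -> yuz.
have yz := cycle_generator gen_z; case: ntu; apply/eqP/set1gP.
rewrite -tiPQ inE Pu; move: yuz; rewrite groupMr //; apply: subsetP.
by rewrite cycle_subG.
Qed.

(** For a neighbour [u * z] with [<[z]> = <[y]>], the second components are powers of each other, so
    comparing [u] with [x] in the chain picks the direction of adjacency to [x * y]. *)
Lemma power_nbhd_max_cyclic_sub p x y :
    prime p -> p.-group P -> cyclic P -> x \in P -> <[y]>%G \in max_cyclic Q ->
  power_nbhd G y \subset power_nbhd G (x * y).
Proof.
move=> pr_p pP cycP Px maxy; have [Qy _] := mem_max_cyclic _ _ maxy.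
have [_ mulPQ _ _] := dprodP defG.
apply/subsetP=> w Nw; have Gw : w \in G by case/setIdP: Nw.
rewrite inE Gw; move: Nw; rewrite power_nbhd_max_cyclic // inE.
case/orP=> [/mulsgP[u z]|yw].
  rewrite !inE => /andP[_ Pu] gen_z ->.
  have yz := cycle_generator gen_z.
  have zy : y \in <[z]> by rewrite -(eqP gen_z) cycle_id.
  have Qz : z \in Q by apply: subsetP yz; rewrite cycle_subG.
  by rewrite !mem_cycle_dprod // yz zy !andbT (cyclic_pgroup_cycle_total pr_p pP).
rewrite -[w]mul1g mem_cycle_dprod ?group1 ?yw //.
by apply: subsetP yw; rewrite cycle_subG.
Qed.

Lemma power_nbhd_generators_leq x y : x \in P -> y \in Q ->
  #|[set u | generator P u]| * #|[set z in Q | y \in <[z]>]|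
    <= #|power_nbhd G (x * y)|.
Proof.
move=> Px Qy; have [_ mulPQ _ tiPQ] := dprodP defG.
have sgP : [set u | generator P u] \subset P.
  by apply/subsetP=> u; rewrite inE => /eqP->; apply: cycle_id.
rewrite -(card_mulg_TI tiPQ) //; last by apply/subsetP=> z /setIdP[].
apply/subset_leq_card/subsetP => _ /mulsgP[u z gen_u /setIdP[Qz zy] ->].
have Pu := subsetP sgP u gen_u; rewrite inE in gen_u.
by rewrite inE -mulPQ mem_mulg //= [X in _ || X]mem_cycle_dprod // -(eqP gen_u) Px zy orbT.
Qed.

Lemma power_nbhd_leq p q x y y0 :
    prime p -> prime q -> 2 < q -> p.-group P -> q.-group Q -> P :!=: 1 ->
    cyclic P -> ~~ cyclic 'Z(Q) -> x \in P -> y \in Q ->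
    <[y0]>%G \in max_cyclic Q ->
    (forall C : {group gT}, C \in max_cyclic Q -> #|<[y0]>| <= #|C|) ->
  #|power_nbhd G y0| <= #|power_nbhd G (x * y)|.
Proof.
move=> pr_p pr_q q_gt2 pP qQ ntP cycP ncZ Px Qy max0 min0.
have [Qy0 _] := mem_max_cyclic _ _ max0.
rewrite (card_power_nbhd_max_cyclic max0).
have [maxy|not_maxy] := boolP (<[y]>%G \in max_cyclic Q).
  apply: leq_trans (subset_leq_card (power_nbhd_max_cyclic_sub pr_p pP cycP Px maxy)).
  (* Both orders are powers of [q], so minimality becomes a comparison of exponents. *)
  have := min0 _ maxy; rewrite (card_power_nbhd_max_cyclic maxy) -!orderE.
  have [i ->] := p_natP (mem_p_elt qQ Qy); have [j ->] := p_natP (mem_p_elt qQ Qy0).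
  rewrite leq_exp2l ?prime_gt1 // => le_ji.
  by rewrite leq_add ?leq_pexp2l ?prime_gt0 // leq_mul // leq_totient_pexp.
have [|C maxC syC] := @maxgroup_exists _ (fun K => cyclic K && (K \subset Q)) <[y]>%G.
  by rewrite cycle_cyclic cycle_subG.
have [/andP[/cyclicP[z defC] sCQ] _] := maxgroupP maxC.
have Qz : z \in Q by rewrite -cycle_subG -defC.
have prop_yz : <[y]> \proper <[z]>.
  rewrite -defC properEneq syC andbT; apply: contraNneq not_maxy => eq_yC.
  by rewrite inE (_ : <[y]>%G = C) //; apply: group_inj.
have le_0z : #[y0] <= #[z].
  by have := min0 C; rewrite inE maxC defC -!orderE => /(_ isT).
apply: leq_trans (power_nbhd_generators_leq Px Qy).
have := card_cycle_overgroups pr_q qQ ncZ Qz prop_yz.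
have := cyclic_pgroup_generators pr_p pP ntP cycP.
have : totient #[y0] <= #[y0].
  rewrite totient_gen subset_leq_card //; apply/subsetP=> g.
  by rewrite inE => /cycle_generator.
move: (#|P|) (cardG_gt0 P) => [|m] // _ /= le_tot le_m le_z.
(* With [m.+1] the order of [P] and [c] its number of generators, the chain continues [m.+1 * #[z]
   <= 2 * c * #[z] <= c * (q.-1 * #[z])], the last step by [2 < q]. *)
apply: (@leq_trans (m.+1 * #[z])).
  by rewrite mulSn addnC leq_add // leq_mul // (leq_trans le_tot).
apply: leq_trans (leq_mul le_m (leqnn _)) _; rewrite mulnAC mulnC leq_mul2l.
rewrite (leq_trans _ le_z) ?orbT // leq_mul2r.
by case: q q_gt2 {pr_q qQ le_z} => // q; rewrite ltnS orbC => ->.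
Qed.

End DirectProduct.
End PowerNeighbourhoods.

Theorem theorem1p4 (gT : finGroupType) (G P1 P2 : {group gT})
    (p1 p2 a1 a2 : nat) (y2 : gT)
    (hp1 : prime p1) (hp2 : prime p2) (hp12 : (p1 < p2)%N)
    (ha1 : (1 <= a1)%N) (ha2 : (1 <= a2)%N)
    (hnil : nilpotent G) (hncyc : ~~ cyclic G)
    (hcard : #|G| = (p1 ^ a1 * p2 ^ a2)%N)
    (hP1 : p1.-Sylow(G) P1) (hP2 : p2.-Sylow(G) P2)
    (hP1cyc : cyclic P1) (hZP2 : ~~ cyclic 'Z(P2))
    (hy2 : <[y2]>%G \in max_cyclic P2)
    (hy2min : forall C : {group gT}, C \in max_cyclic P2 -> (#|<[y2]>| <= #|C|)%N) :
  power_min_deg G = power_deg G y2.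
Proof.
have p1G := pHall_pgroup hP1; have p2G := pHall_pgroup hP2.
(* Only [p1] and [p2] divide the order of [G], so the [p2]-part is the [p1^']-part and nilpotency
   splits [G]. *)
have hP2' : p1^'.-Hall(G) P2.
  rewrite pHallE (pHall_sub hP2) (card_Hall hP2) /=; apply/eqP/eq_in_partn => r.
  rewrite hcard mem_primes => /and3P[pr_r _].
  rewrite Euclid_dvdM // !Euclid_dvdX // !dvdn_prime2 // !inE.
  have ne12 : p1 != p2 by rewrite neq_ltn hp12.
  by case/orP=> /andP[/eqP-> _]; rewrite eqxx ?(negPf ne12) // eq_sym ne12.
have defG : P1 \x P2 = G.
  rewrite (nilpotent_Hall_pcore hnil hP1) (nilpotent_Hall_pcore hnil hP2').
  exact: nilpotent_pcoreC.
have coP : coprime #|P1| #|P2| := pnat_coprime p1G (pHall_pgroup hP2').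
have ntP1 : P1 :!=: 1.
  rewrite -cardG_gt1 (card_Hall hP1) p_part (ltn_exp2l 0) ?prime_gt1 //.
  by rewrite logn_gt0 mem_primes hp1 cardG_gt0 hcard dvdn_mulr // dvdn_exp.
have Gy2 : y2 \in G.
  by apply: (subsetP (pHall_sub hP2)); have [] := mem_max_cyclic _ _ hy2.
apply/eqP; rewrite eqn_leq /power_min_deg.
case: arg_minnP => [|v Gv minv]; first exact: group1.
(* One inequality is minimality of [v]; in the other, adding 1 to both degrees gives closed
   neighbourhoods. *)
rewrite minv //= -ltnS -!card_power_nbhd //.
have [x [y [P1x P2y -> _]]] := mem_dprod defG Gv.
apply: (power_nbhd_leq defG coP hp1 hp2) => //.
exact: leq_ltn_trans (prime_gt1 hp1) hp12.
Qed.
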